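(* Let $\{S(t): t\ge 0\}$ be a semigroup in a metric space $(V,d)$, $T>0$ and $B$ be a subset of $V$. Let $Y,Z$ be normed spaces such that $Z$ is compactly embedded into $Y$. Assume that there exists a map $M:B\to Z$ and parameters $\eta\in[0,1)$, $\mu>0$ and $\kappa>0$ such that for all $x,y\in B$ $$\|Mx-My\|_Z\le\kappa\, d(x,y)$$ and $$d(S(T)x,S(T)y)\le\eta\, d(x,y)+\mu\|Mx-My\|_Y$$ hold. Then $\{S(t): t\ge 0\}$ is quasi-stable on $B$ at time $T$ with parameters $(\eta,\kappa\mu)$ and the compact seminorm $\mathfrak{n}_Z(x)=\|x\|_Y$ on $Z$.
   Context: A semigroup $\{S(t):t\ge0\}$ on a metric space $(V,d)$ is a family of maps $S(t):V\to V$ with $S(t)S(s)=S(t+s)$ for $t,s\ge 0$ and $S(0)=I$; ''$t\ge 0$'' means throughout either $t\in[0,\infty)$ or $t\in\mathbb{N}_0$ (and $T$ belongs to the time set). A compact seminorm on a normed space $Z$ is a seminorm $\mathfrak{n}_Z:Z\to[0,\infty)$ such that any bounded sequence $z_k\in Z$ has a subsequence $z_{k_j}$ with $\mathfrak{n}_Z(z_{k_j}-z_{k_l})\to0$ as $j,l\to\infty$. The semigroup is quasi-stable on a set $B\subseteq V$ at time $T>0$ with respect to a compact seminorm $\mathfrak{n}_Z$ on a normed space $Z$ and parameters $(\eta',\kappa')$ if $\eta'\in[0,1)$, $\kappa'>0$ and there is a map $K:B\to Z$ such that for all $x,y\in B$ $$\|Kx-Ky\|_Z\le\kappa'\, d(x,y),\qquad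 d(S(T)x,S(T)y)\le\eta'\, d(x,y)+\mathfrak{n}_Z(Kx-Ky).$$ *)

(* Defs.v *)
From HB Require Import structures.
From mathcomp Require Import all_boot all_order all_algebra.
From mathcomp Require Import all_classical all_reals all_analysis.

Set Implicit Arguments.
Unset Strict Implicit.
Unset Printing Implicit Defensive.

Import Order.TTheory GRing.Theory Num.Theory.
Import numFieldNormedType.Exports.

Local Open Scope classical_set_scope.
Local Open Scope ring_scope.

Inductive time_kind := continuous_time | discrete_time.

(* Discrete times are embedded in the reals, so that both kinds of semigroup
   are families of maps indexed by (a subset of) R. *)
Definition time_set (R : realType) (k : time_kind) : set R :=
  match k with
  | continuous_time => [set t | 0 <= t]
  | discrete_time => range (fun n : nat => n%:R)
  end.

(* The values of S outside the time set are irrelevant. *)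
Definition is_semigroup (R : realType) (V : metricType R) (k : time_kind)
    (S : R -> V -> V) : Prop :=
  (forall t s, time_set k t -> time_set k s ->
     forall x, S t (S s x) = S (t + s) x) /\
  (forall x, S 0 x = x).

Definition is_seminorm (R : realType) (Z : normedModType R) (n : Z -> R) :
    Prop :=
  [/\ forall x, 0 <= n x,
      forall x y, n (x + y) <= n x + n y
    & forall (a : R) x, n (a *: x) = `|a| * n x].

Definition compact_seminorm (R : realType) (Z : normedModType R)
    (n : Z -> R) : Prop :=
  is_seminorm n /\
  forall z : nat -> Z, bounded_fun z ->
    exists2 phi : nat -> nat, increasing_seq phi &
      n (z (phi p.1) - z (phi p.2)) @[p --> (\oo, \oo)] --> (0 : R).

(* The inclusion of Z into Y is represented by an injective linear map i;
   precompact means that the closure (in Y) is compact. *)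
Definition compact_embedding (R : realType) (Z Y : normedModType R)
    (i : {linear Z -> Y}) : Prop :=
  [/\ injective i, continuous i
    & forall A : set Z, bounded_set A -> precompact (i @` A)].

(* Maps defined on B are represented by total maps on V; only their values on
   B matter. *)
Definition quasi_stable (R : realType) (V : metricType R) (k : time_kind)
    (S : R -> V -> V) (B : set V) (T : R) (Z : normedModType R)
    (n : Z -> R) (eta' kappa' : R) : Prop :=
  [/\ is_semigroup k S,
      time_set k T /\ 0 < T,
      compact_seminorm n,
      0 <= eta' < 1 /\ 0 < kappa'
    & exists K : V -> Z, forall x y, B x -> B y ->
        `|K x - K y| <= kappa' * mdist x y /\
        mdist (S T x) (S T y) <= eta' * mdist x y + n (K x - K y)].

(* Main.v *)
Require Import Defs.
From HB Require Import structures.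
From mathcomp Require Import all_boot all_order all_algebra.
From mathcomp Require Import all_classical all_reals all_analysis.

Set Implicit Arguments.
Unset Strict Implicit.
Unset Printing Implicit Defensive.

Import Order.TTheory GRing.Theory Num.Theory.
Import numFieldNormedType.Exports.

Local Open Scope classical_set_scope.
Local Open Scope ring_scope.

(** The factor [mu] can be absorbed into the map: with [K = mu *: M], homogeneity turns
    [mu * |i (M x - M y)|] into [|i (K x - K y)|] and multiplies the Lipschitz constant by [mu]. The
    substance is [compact_embedding_compact_seminorm]: the embedding sends a bounded sequence into a
    compact set, where [compact_cvg_subsequence] extracts a convergent, hence Cauchy,
    subsequence. *)

Lemma compact_cvg_subsequence (R : realType) (Y : normedModType R) (A : set Y)
    (u : nat -> Y) :
  compact A -> (forall n, A (u n)) ->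
  exists l : Y,
    exists2 phi : nat -> nat, increasing_seq phi & u \o phi @ \oo --> l.
Proof.
move=> cA Au.
have [l [_ clul]] : A `&` cluster (u @ \oo) !=set0.
  by apply: cA; exists 0 => // n _; exact: Au.
(* The library only extracts subsequences along cluster points of real
   sequences, so we apply it to the distances to l. *)
have clu0 : cluster ((fun n => `|l - u n|) @ \oo) 0.
  move=> P Q uP Q0.
  have dist0 : `|l - y| @[y --> l] --> (0 : R).
    rewrite -[X in _ --> X](normr0 Y) -[in X in _ --> X](subrr l).
    by apply: cvg_norm; apply: cvgB; [exact: cvg_cst|exact: cvg_id].
  (* Clustering at [l] passes through the distance to [l], which is continuous there: both preimages
     are admissible test sets for [clul]. *)
  have [y [Py Qy]] := clul ((fun y => `|l - y|) @^-1` P) _ uP (dist0 _ Q0).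
  by exists `|l - y|.
have /cluster_eventually_cvg[phi phiS phi0] := clu0.
exists l, phi => //; apply/cvgrPdist_lt => e e0.
have /cvgrPdist_lt/(_ e e0) := phi0.
by apply: filterS => n /=; rewrite sub0r normrN normr_id.
Qed.

Lemma compact_embedding_compact_seminorm (R : realType)
    (Z Y : normedModType R) (i : {linear Z -> Y}) :
  compact_embedding i -> compact_seminorm (fun z => `|i z|).
Proof.
case=> _ _ ci; split.
  split=> [//|x y|a x]; first by rewrite linearD ler_normD.
  by rewrite linearZ normrZ.
move=> z [b [breal zb]].
have : compact (closure (i @` range z)).
  rewrite -precompactE; apply: ci.
  by exists b; split => // c /zb zc _ [n _ <-]; exact: zc.
move=> /(@compact_cvg_subsequence _ _ _ (i \o z))[n|l [phi phiS izl]].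
  by apply: subset_closure; exists (z n) => //; exists n.
exists phi => //.
(* With 0 written as [|l - l|], the Cauchy property becomes a limit of differences, each index
   converging to [l] along its own projection of the product filter. *)
rewrite -[X in _ --> X](normr0 Y) -[in X in _ --> X](subrr l).
under eq_fun do rewrite linearB.
apply: cvg_norm; apply: cvgB.
- exact: (cvg_comp _ _ cvg_fst izl).
- exact: (cvg_comp _ _ cvg_snd izl).
Qed.

Theorem proposition4p1 (R : realType) (V : metricType R) (k : time_kind)
    (S : R -> V -> V) (hS : is_semigroup k S)
    (T : R) (hTk : time_set k T) (hT : 0 < T) (B : set V)
    (Y Z : normedModType R) (i : {linear Z -> Y}) (hi : compact_embedding i)
    (M : V -> Z) (eta mu kappa : R)
    (heta : 0 <= eta < 1) (hmu : 0 < mu) (hkappa : 0 < kappa)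
    (hLip : forall x y, B x -> B y -> `|M x - M y| <= kappa * mdist x y)
    (hST : forall x y, B x -> B y ->
       mdist (S T x) (S T y) <= eta * mdist x y + mu * `|i (M x - M y)|) :
  quasi_stable k S B T (fun z : Z => `|i z|) eta (kappa * mu).
Proof.
split => //; first exact: compact_embedding_compact_seminorm.
  by split => //; exact: mulr_gt0.
(* Positivity of [mu] gives [|mu| = mu], so the second estimate becomes exactly [hST]. *)
exists (fun x => mu *: M x) => x y Bx By.
rewrite -scalerBr linearZ !normrZ gtr0_norm//; split; last exact: hST.
by rewrite [kappa * mu]mulrC -mulrA ler_pM2l// hLip.
Qed.
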